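(* Let $s$ be a Sturmian word. Then $s\in\mathcal P_3$.
   Context: For a finite word $u$ and a letter $x$, $|u|$ is the length of $u$ and $|u|_x$ the number of occurrences of $x$ in $u$. An infinite word $s\in\{a,b\}^\omega$ is Sturmian if it is aperiodic (not of the form $vu^\omega$ with $v$ a finite, possibly empty, word and $u$ a non-empty finite word) and balanced, i.e. $\big||u|_x-|v|_x\big|\le1$ for every $x\in\{a,b\}$ and all factors $u,v$ of $s$ with $|u|=|v|$. $\mathrm{Fact}^+s$ is the set of non-empty finite factors (contiguous blocks) of $s$. A factorization of $s$ is an expression $s=U_1U_2U_3\cdots$ with all $U_i$ non-empty finite words. For $k\ge 2$, $\mathcal P_k$ is the class of infinite words $s$ over finite alphabets for which there is a map (coloring) $c:\mathrm{Fact}^+s\to C$ with $\mathrm{card}(C)=k$ such that for each factorization $s=U_1U_2U_3\cdots$ there exist $i,j\ge1$ with $c(U_i)\ne c(U_j)$. *)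

(* Defs.v *)
From mathcomp Require Import all_boot ssrint.
Set Implicit Arguments.
Unset Strict Implicit.
Unset Printing Implicit Defensive.

(* Infinite words are functions [nat -> A]: the letter in position [i],
   counted from 0, is [s i]. *)

Definition factor (A : finType) (s : nat -> A) (u : seq A) : Prop :=
  exists i : nat, u = mkseq (fun j => s (i + j)) (size u).

(* s = U_0 U_1 U_2 ...: every finite product U_0 ... U_(n-1) is a prefix of s.
   This determines s as soon as infinitely many U_i are non-empty, which is
   the case in both uses below. *)
Definition infinite_product (A : finType) (U : nat -> seq A) (s : nat -> A)
    : Prop :=
  forall n : nat,
    flatten (mkseq U n) = mkseq s (size (flatten (mkseq U n))).

Definition factorization (A : finType) (s : nat -> A) (U : nat -> seq A)
    : Prop :=
  (forall i : nat, U i <> [::]) /\ infinite_product U s.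

(* s is not of the form v u u u ... with u non-empty. *)
Definition aperiodic (A : finType) (s : nat -> A) : Prop :=
  ~ exists v u : seq A,
      u <> [::] /\
      infinite_product (fun i : nat => if i is 0 then v else u) s.

Definition balanced (A : finType) (s : nat -> A) : Prop :=
  forall (x : A) (u v : seq A),
    factor s u -> factor s v -> size u = size v ->
    `|count_mem x u - count_mem x v|%N <= 1.

(* The two-letter alphabet {a, b} is [bool]. *)
Definition sturmian (s : nat -> bool) : Prop := aperiodic s /\ balanced s.

(* A coloring of the non-empty factors of s is given by a map on all finite
   words.  Its values on other words are irrelevant, since the terms of a
   factorization of s are non-empty factors of s; and every coloring of the
   non-empty factors extends, as C is then non-empty. *)
Definition in_P (k : nat) (A : finType) (s : nat -> A) : Prop :=
  exists (C : finType) (c : seq A -> C),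
    #|C| = k /\
    forall U : nat -> seq A, factorization s U ->
      exists i j : nat, c (U i) <> c (U j).

(* Main.v *)
Require Import Defs.
From Stdlib Require Import Classical.
From mathcomp Require Import all_boot.

(**
Only the fact that s is not of the form u^omega matters.  Give one color to
the words that are not prefixes of s, and color a prefix u, s = u y, according
to whether y < s or y > s in the lexicographic order (y = s would make s
periodic).  In a monochromatic factorization s = U_0 U_1 ... all the U_i are
then prefixes of s, since U_0 is, and say s < U_i s for all i.  Hence
s < U_0 s < U_0 U_1 s < ..., which is absurd because this increasing sequence
converges to s.  The case s > U_i s is symmetric.
*)

Section Descent.

Variables (A : eqType) (r : rel A).
Hypotheses (r_irr : irreflexive r) (r_trans : transitive r).
Implicit Types (s : nat -> A) (m n p q : nat).

Definition shift_lt_at s n p : Prop :=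
  (forall q, q < p -> s (n + q) = s q) /\ r (s (n + p)) (s p).

(* The first mismatch of s with u s, |u| = n, is at position n + p: it does not
   increase along the products u = U_0 ... U_i, although |u| tends to
   infinity. *)
Lemma shift_lt_add s n m p p' :
  (forall q, q < m -> s (n + q) = s q) ->
  shift_lt_at s n p -> shift_lt_at s m p' ->
  exists2 p'', n + m + p'' <= n + p & shift_lt_at s (n + m) p''.
Proof.
move=> eq_m [eq_p lt_p] [eq_p' lt_p'].
have le_mp : m <= p.
  by rewrite leqNgt; apply/negP => /eq_m e; move: lt_p; rewrite e r_irr.
have eq_pm q : q < p - m -> s (n + m + q) = s (m + q).
  by rewrite ltn_subRL -addnA; apply: eq_p.
have lt_pm : r (s (n + m + (p - m))) (s (m + (p - m))).
  by rewrite -addnA subnKC.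
(* The shift by [n + m] follows the shift by [m] up to [p - m], and the latter follows [s] up to
   [p']; if both break at once, transitivity of [r] concludes. *)
exists (minn (p - m) p').
  by rewrite -addnA leq_add2l -{2}(subnKC le_mp) leq_add2l geq_minl.
split=> [q|]; first by rewrite ltn_min => /andP[/eq_pm -> /eq_p' ->].
case: (ltngtP (p - m) p') => [lt | lt | eq].
- by rewrite -(eq_p' _ lt).
- by rewrite (eq_pm _ lt).
- by rewrite eq in lt_pm *; apply: r_trans lt_pm lt_p'.
Qed.

(** The mismatch for a product of blocks never lies beyond that for the first block, yet the
    products grow without bound. *)
Lemma no_lt_prefix_factorization s (l : nat -> nat) :
  (forall i, 0 < l i) ->
  (forall i q, q < l i -> s (\sum_(j < i) l j + q) = s q) ->
  ~ (forall i, exists p, shift_lt_at s (l i) p).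
Proof.
move=> l_gt0 l_pre l_lt; have [p0 lt0] := l_lt 0.
have bounded i : exists2 p, \sum_(j < i.+1) l j + p <= l 0 + p0
    & shift_lt_at s (\sum_(j < i.+1) l j) p.
  elim: i => [|i [p le_p lt_p]]; first by exists p0; rewrite big_ord1.
  have [p' lt_p'] := l_lt i.+1.
  have [p'' le_p'' lt_p''] := shift_lt_add _ _ _ _ _ (l_pre i.+1) lt_p lt_p'.
  by rewrite big_ord_recr /=; exists p'' => //; apply: leq_trans le_p'' le_p.
have le_sum i : i <= \sum_(j < i) l j.
  elim: i => // i IH; rewrite big_ord_recr /= -addn1.
  by apply: leq_add => //; apply: l_gt0.
have [p le_p _] := bounded (l 0 + p0).
have := leq_trans (le_sum _) (leq_trans (leq_addr p _) le_p).
by rewrite ltnn.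
Qed.

End Descent.

Lemma mkseqD (T : Type) (f : nat -> T) (m n : nat) :
  mkseq f (m + n) = mkseq f m ++ mkseq (fun i => f (m + i)) n.
Proof.
by rewrite /mkseq iotaD map_cat add0n -[X in iota X n]addn0 iotaDl -map_comp.
Qed.

Lemma aperiodic_mismatch (A : finType) (s : nat -> A) : aperiodic s ->
  forall n, exists p, s (n.+1 + p) != s p.
Proof.
move=> aper n; apply: NNPP => no_mismatch; apply: aper.
have per p : s (n.+1 + p) = s p.
  by apply/eqP/negbNE/negP => neq; apply: no_mismatch; exists p.
(* The preperiod is empty, so [k.+1] terms contain only [k] copies of the period. *)
exists [::], (mkseq s n.+1); split=> // -[//|k].
suff -> : flatten (mkseq (fun i => if i is 0 then [::] else mkseq s n.+1) k.+1)
          = mkseq s (k * n.+1) by rewrite size_mkseq.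
elim: k => // k IH; rewrite mkseqS flatten_rcons IH mulSnr mkseqD.
congr (_ ++ _); apply: eq_mkseq => i {IH}.
by elim: k => // k ->; rewrite mulSn -addnA per.
Qed.

Lemma factorization_term (A : finType) (s : nat -> A) (U : nat -> seq A) i :
  infinite_product U s ->
  U i = mkseq (fun q => s (\sum_(j < i) size (U j) + q)) (size (U i)).
Proof.
move=> prodU.
have sz n : size (flatten (mkseq U n)) = \sum_(j < n) size (U j).
  elim: n => [|n IH]; first by rewrite big_ord0.
  by rewrite mkseqS flatten_rcons size_cat IH big_ord_recr.
(* Cancel the common prefix formed by the first [i] terms. *)
have := prodU i.+1; rewrite mkseqS flatten_rcons size_cat mkseqD prodU.
by rewrite size_mkseq sz => /eqP; rewrite eqseq_cat // eqxx => /eqP.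
Qed.

Lemma aperiodic_in_P3 (A : finType) (s : nat -> A) : aperiodic s -> in_P 3 s.
Proof.
move=> /aperiodic_mismatch mis.
pose r (x y : A) := enum_rank x < enum_rank y.
have r_irr : irreflexive r by move=> x; apply: ltnn.
have r_trans : transitive r by move=> y x z; apply: ltn_trans.
(* [mis] is indexed by the shift minus one; the arbitrary value at [n = 0] is harmless, as all
   blocks are non-empty. *)
pose p n := ex_minn (mis n.-1).
pose c (u : seq A) := if u == mkseq s (size u)
  then Some (r (s (size u + p (size u))) (s (p (size u)))) else None.
exists (option bool), c; split; first by rewrite card_option card_bool.
move=> U [U_neq0 prodU]; apply: NNPP => no_pair.
have mono i : c (U i) = c (U 0).
  by apply/eqP/negbNE/negP => /eqP neq; apply: no_pair; exists i, 0.
(* [U 0] is a prefix of [s], so the common color is not [None]. *)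
have U_pre i : U i = mkseq s (size (U i)).
  have U0_pre : U 0 == mkseq s (size (U 0)).
    rewrite {1}(factorization_term _ _ _ 0 prodU).
    by apply/eqP/eq_mkseq => q; rewrite big_ord0.
  by have := mono i; rewrite /c U0_pre; case: eqP.
have l_gt0 i : 0 < size (U i) by case: (U i) (U_neq0 i).
have l_pre i q : q < size (U i) -> s (\sum_(j < i) size (U j) + q) = s q.
  move=> lt_q; rewrite -[RHS](nth_mkseq (s 0) s lt_q) -U_pre.
  by rewrite (factorization_term _ _ _ i prodU) nth_mkseq.
have first_mis i (l := size (U i)) :
    (forall q, q < p l -> s (l + q) = s q) /\ s (l + p l) != s (p l).
  rewrite /p; case: ex_minnP => m; rewrite (prednK (l_gt0 i)) => neq min_m.
  by split=> // q; apply: contraTeq; rewrite -leqNgt; apply: min_m.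
have lt_mono i (l := size (U i)) :
    r (s (l + p l)) (s (p l)) = r (s (size (U 0) + p (size (U 0))))
                                  (s (p (size (U 0)))).
  by have := mono i; rewrite /c -!U_pre !eqxx => -[].
case lt0 : (r _ _) in lt_mono.
- apply: (no_lt_prefix_factorization A r r_irr r_trans s _ l_gt0 l_pre) => i.
  by exists (p (size (U i))); split; [case: (first_mis i) | rewrite lt_mono].
(* All shifts are now larger than [s]: descend for the reversed order. *)
- have r'_trans : transitive (fun x y => r y x).
    by move=> y x z ryx rzy; apply: r_trans rzy ryx.
  apply: (no_lt_prefix_factorization A (fun x y => r y x) r_irr r'_trans s _
    l_gt0 l_pre) => i.
  have [eq_p neq_p] := first_mis i; exists (p (size (U i))); split=> //.
  (* Distinct letters have distinct ranks, so at a mismatch the failure of [r] reverses it. *)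
  have := lt_mono i; rewrite /r => /negbT; rewrite -leqNgt leq_eqVlt.
  by rewrite (inj_eq val_inj) (inj_eq enum_rank_inj) eq_sym (negPf neq_p).
Qed.

Theorem corollary6p10 (s : nat -> bool) (hs : sturmian s) : in_P 3 s.
Proof. by apply: aperiodic_in_P3; case: hs. Qed.
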